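(* There exist a constant $d$ and a polynomial $p$ such that for every non-bipartite finite simple graph $\mathcal{G}$ with vertex set $\{0,\dots,n-1\}$ and every bipartite finite simple graph $\mathcal{H}$ with vertex set $\{0,\dots,m-1\}$, the propositional tautology $\tau_{\mathcal{G},\mathcal{H}}$ (expressing that there is no homomorphism from $\mathcal{G}$ to $\mathcal{H}$) has a depth-$d$ Frege proof of size at most $p(n,m)$. That is, the family of tautologies $\tau_{\mathcal{G},\mathcal{H}}$ has polynomial size bounded depth Frege proofs.
   Context: Graphs are undirected, without loops. A homomorphism $\mathcal{G}\to\mathcal{H}$ is a map $h$ from vertices of $\mathcal{G}$ to vertices of $\mathcal{H}$ such that adjacent vertices are mapped to adjacent vertices. For $\mathcal{G}$ on $\{0,\dots,n-1\}$ and $\mathcal{H}$ on $\{0,\dots,m-1\}$, introduce propositional variables $p_{i,j}$ ($i<n$, $j<m$), meaning ''vertex $i$ is mapped to vertex $j$''. Then $\tau_{\mathcal{G},\mathcal{H}}$ is the formula $$\Big[\bigvee_{i<n}\bigwedge_{j<m}\neg p_{i,j}\Big]\vee\Big[\bigvee_{i<n}\bigvee_{j_1\neq j_2<m}(p_{i,j_1}\wedge p_{i,j_2})\Big]\vee\Big[\bigvee_{\substack{i_1,i_2<n\\ \{i_1,i_2\}\in E(\mathcal{G})}}\ \bigvee_{\substack{j_1,j_2<m\\ \{j_1,j_2\}\notin E(\mathcal{H})}}(p_{i_1,j_1}\wedge p_{i_2,j_2})\Big],$$ (the propositional translation of the statement that no set $Z$ codes a homomorphism from $\mathcal{G}$ to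 $\mathcal{H}$), which is a tautology whenever no homomorphism $\mathcal{G}\to\mathcal{H}$ exists. A depth-$d$ Frege proof is a proof in a (fixed) Frege propositional proof system in which all formulas have depth at most $d$ (constant-depth Frege). *)

(* Defs.v *)
From HB Require Import structures.
From mathcomp Require Import all_boot all_order all_algebra.

Set Implicit Arguments.
Unset Strict Implicit.
Unset Printing Implicit Defensive.

Definition simple_graph (n : nat) (e : rel 'I_n) : Prop :=
  symmetric e /\ irreflexive e.

Definition bipartite (n : nat) (e : rel 'I_n) : Prop :=
  exists A : {set 'I_n}, forall x y, e x y -> (x \in A) != (y \in A).

Inductive formula (V : Type) : Type :=
| Var of V
| Bot
| Top
| Neg of formula V
| And of formula V & formula V
| Or of formula V & formula V.

Arguments Bot {V}.
Arguments Top {V}.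

Definition formula_comparable (V : eqType) : comparable (formula V).
Proof.
by rewrite /comparable /decidable; decide equality; apply: eq_comparable.
Defined.

HB.instance Definition _ (V : eqType) :=
  hasDecEq.Build (formula V) (compareP (@formula_comparable V)).

Fixpoint eval (V : Type) (v : V -> bool) (A : formula V) : bool :=
  match A with
  | Var x => v x
  | Bot => false
  | Top => true
  | Neg B => ~~ eval v B
  | And B C => eval v B && eval v C
  | Or B C => eval v B || eval v C
  end.

Definition entails (V : Type) (hyps : seq (formula V)) (A : formula V) : Prop :=
  forall v : V -> bool, all (eval v) hyps -> eval v A.

Fixpoint subst (U V : Type) (s : U -> formula V) (A : formula U) : formula V :=
  match A with
  | Var x => s x
  | Bot => Bot
  | Top => Top
  | Neg B => Neg (subst s B)
  | And B C => And (subst s B) (subst s C)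
  | Or B C => Or (subst s B) (subst s C)
  end.

(* Number of occurrences of atoms, constants and connectives. *)
Fixpoint fsize (V : Type) (A : formula V) : nat :=
  match A with
  | Var _ | Bot | Top => 1
  | Neg B => (fsize B).+1
  | And B C | Or B C => (fsize B + fsize C).+1
  end.

Definition is_neg (V : Type) (A : formula V) : bool :=
  if A is Neg _ then true else false.
Definition is_and (V : Type) (A : formula V) : bool :=
  if A is And _ _ then true else false.
Definition is_or (V : Type) (A : formula V) : bool :=
  if A is Or _ _ then true else false.

(* The connectives being binary, the depth of bounded-depth Frege counts the
   alternations of connectives: a connective adds 1 only above a subformula
   whose outermost symbol differs from it, so that an iterated disjunction of
   formulas of depth at most k has depth at most k + 1. *)
Fixpoint depth (V : Type) (A : formula V) : nat :=
  match A with
  | Var _ | Bot | Top => 0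
  | Neg B => depth B + ~~ is_neg B
  | And B C => maxn (depth B + ~~ is_and B) (depth C + ~~ is_and C)
  | Or B C => maxn (depth B + ~~ is_or B) (depth C + ~~ is_or C)
  end.

(* A schematic rule; its instances are obtained by substituting formulas for
   the atoms.  A rule without premises is an axiom scheme. *)
Definition rule : Type := (seq (formula nat) * formula nat)%type.
HB.instance Definition _ := Equality.on rule.

Definition premises (r : rule) : seq (formula nat) := r.1.
Definition conclusion (r : rule) : formula nat := r.2.

Definition infers (F : seq rule) (V : eqType) (prev : seq (formula V))
    (A : formula V) : Prop :=
  exists r s, [/\ r \in F, A = subst s (conclusion r) &
    forall B, B \in premises r -> subst s B \in prev].

Definition derivation (F : seq rule) (V : eqType) (hyps : seq (formula V))
    (A : formula V) (pi : seq (formula V)) : Prop :=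
  (exists pi', pi = rcons pi' A) /\
  forall k, k < size pi ->
    nth Bot pi k \in hyps \/ infers F (take k pi) (nth Bot pi k).

(* Frege systems over the De Morgan language, in the sense of Cook and Reckhow:
   finite sets of rules that are sound and implicationally complete. *)
Definition frege_system (F : seq rule) : Prop :=
  (forall r, r \in F -> entails (premises r) (conclusion r)) /\
  (forall (hyps : seq (formula nat)) (A : formula nat), entails hyps A ->
    exists pi, derivation F hyps A pi).

Definition frege_proof (F : seq rule) (V : eqType) (A : formula V)
    (pi : seq (formula V)) : Prop :=
  derivation F [::] A pi.

Definition proof_size (V : Type) (pi : seq (formula V)) : nat :=
  \sum_(A <- pi) fsize A.

Definition proof_depth_le (V : Type) (d : nat) (pi : seq (formula V)) : Prop :=
  all (fun A => depth A <= d) pi.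

Notation "\OR_ ( i : T | P ) F" := (\big[@Or _/Bot]_(i : T | P) F)
  (at level 41, F at level 41, i at level 50, T at level 50,
   format "\OR_ ( i : T | P ) F").
Notation "\OR_ ( i : T ) F" := (\big[@Or _/Bot]_(i : T) F)
  (at level 41, F at level 41, i at level 50, T at level 50,
   format "\OR_ ( i : T ) F").
Notation "\AND_ ( i : T ) F" := (\big[@And _/Top]_(i : T) F)
  (at level 41, F at level 41, i at level 50, T at level 50,
   format "\AND_ ( i : T ) F").

Definition tau (n m : nat) (G : rel 'I_n) (H : rel 'I_m) :
    formula ('I_n * 'I_m)%type :=
  let p (i : 'I_n) (j : 'I_m) := Var (i, j) in
  Or (\OR_(i : 'I_n) \AND_(j : 'I_m) Neg (p i j))
  (Or (\OR_(i : 'I_n) \OR_(jj : 'I_m * 'I_m | jj.1 != jj.2)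
         And (p i jj.1) (p i jj.2))
      (\OR_(ii : 'I_n * 'I_n | G ii.1 ii.2)
         \OR_(jj : 'I_m * 'I_m | ~~ H jj.1 jj.2)
         And (p ii.1 jj.1) (p ii.2 jj.2))).

(* Main.v *)
Require Import Defs.
From mathcomp Require Import all_boot all_order all_algebra.
From mathcomp Require Import zify.

(* Fix a bipartition of H and let Q(y, b), for a side b, be the disjunction of
   the p_{y,j} with j on side b.  Modulo tau, exactly one of Q(y, false) and
   Q(y, true) holds, and Q(y, b) implies Q(z, ~~ b) along every edge yz of G.
   As G is not bipartite, its bipartite double cover has a walk of length at
   most 2n from some (x, false) to (x, true); chaining the implications along
   this walk and its reverse gives Q(x, false) <-> Q(x, true), hence tau.
   By implicational completeness each of the finitely many schematic rules used
   has a fixed derivation in F, whose substitution instances cost only a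
   constant factor in size and an additive constant in depth. *)

Set Implicit Arguments.
Unset Strict Implicit.
Unset Printing Implicit Defensive.

(** * Size and depth under substitution *)

Lemma subst_subst (U V W : Type) (s : V -> formula W) (t : U -> formula V) A :
  subst s (subst t A) = subst (fun x => subst s (t x)) A.
Proof.
by elim: A => //= [A -> | A -> B -> | A -> B ->].
Qed.

Lemma fsize_gt0 (V : Type) (A : formula V) : 0 < fsize A.
Proof. by case: A. Qed.

Lemma fsize_subst (U V : Type) (s : U -> formula V) S A :
  (forall x, fsize (s x) <= S) -> 0 < S -> fsize (subst s A) <= fsize A * S.
Proof.
move=> hs S_gt0; elim: A => [x||| A IH | A IHA B IHB | A IHA B IHB] /=;
  rewrite ?mul1n //; nia.
Qed.

(** Each connective of [A] adds at most one to the depth, so instances of a fixed formula exceed [d]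
    by a constant only. *)
Lemma depth_subst (U V : Type) (s : U -> formula V) d A :
  (forall x, depth (s x) <= d) -> depth (subst s A) <= fsize A + d.
Proof.
move=> hs; elim: A => [x||| A IH | A IHA B IHB | A IHA B IHB] //=.
- exact: leq_trans (hs x) (leq_addl _ _).
- by case: (is_neg _); lia.
- by case: (is_and _); case: (is_and _); lia.
- by case: (is_or _); case: (is_or _); lia.
Qed.

(** * Simulating finitely many schematic rules inside a Frege system *)

Section Simulation.

Variables (F : seq rule) (V : eqType).

(** Proofs with no distinguished last line, so that they can be concatenated freely. *)
Inductive proves : seq (formula V) -> Prop :=
| proves_nil : proves [::]
| proves_rcons pi A : proves pi -> infers F pi A -> proves (rcons pi A).

Lemma infers_sub (pi pi' : seq (formula V)) A :
  {subset pi <= pi'} -> infers F pi A -> infers F pi' A.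
Proof. by move=> sub [r [s [rF -> h]]]; exists r, s; split=> // B /h/sub. Qed.

Lemma proves_cat pi pi' : proves pi -> proves pi' -> proves (pi ++ pi').
Proof.
move=> hpi; elim=> [|pi'' A _ IH hA]; first by rewrite cats0.
rewrite -rcons_cat; apply: proves_rcons => //.
by apply: infers_sub hA => B; rewrite mem_cat => ->; rewrite orbT.
Qed.

(** A line may be repeated, because the inference that produced it survives in any longer list. This
    discharges hypotheses and moves a target to the end. *)
Lemma proves_infers pi A : proves pi -> A \in pi -> infers F pi A.
Proof.
elim=> // pi' B _ IH hB; rewrite mem_rcons inE.
have sub : {subset pi' <= rcons pi' B}.
  by move=> C; rewrite mem_rcons inE => ->; rewrite orbT.
by case/predU1P=> [->|/IH hA]; [apply: infers_sub hB | apply: infers_sub hA].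
Qed.

Lemma proves_nth pi k : proves pi -> k < size pi ->
  infers F (take k pi) (nth Bot pi k).
Proof.
elim=> // pi' A _ IH hA; rewrite size_rcons ltnS nth_rcons -cats1 take_cat.
rewrite leq_eqVlt => /predU1P[->|lt_k]; last by rewrite lt_k; exact: IH.
by rewrite ltnn eqxx subnn take0 cats0.
Qed.

Lemma proves_frege_proof pi A : proves pi -> A \in pi ->
  frege_proof F A (rcons pi A).
Proof.
move=> hpi Api; split; first by exists pi.
move=> k lt_k; right; apply: proves_nth => //.
by apply: proves_rcons => //; apply: proves_infers.
Qed.

(** Instances of hypotheses become repetitions of lines of [pi]; inferences stay inferences after
    composing their substitutions with [s]. *)
Lemma proves_derivation (s : nat -> formula V) hyps A rho pi :
  derivation F hyps A rho -> proves pi ->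
  {subset map (subst s) hyps <= pi} -> proves (pi ++ map (subst s) rho).
Proof.
move=> [_ hrho] hpi sub; rewrite -(take_size rho).
(* Induction on the length of the prefix of [rho] already appended. *)
move: (leqnn (size rho)); move: {1 3}(size rho) => k.
elim: k => [_|k IH lt_k].
  by rewrite take0 cats0.
rewrite (take_nth Bot lt_k) map_rcons -rcons_cat.
have {}IH := IH (ltnW lt_k); apply: proves_rcons => //.
case: (hrho k lt_k) => [in_hyps|[r [t [rF -> hprem]]]].
  apply: proves_infers => //; rewrite mem_cat sub //.
  exact: map_f.
exists r, (fun x => subst s (t x)); split=> //; first exact: subst_subst.
by move=> B /hprem Bin; rewrite mem_cat -subst_subst map_f ?orbT.
Qed.

Variables (rules : seq rule) (c d S : nat).

Hypothesis rules_derivable : forall r, r \in rules -> exists2 rho,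
  derivation F (premises r) (conclusion r) rho & proof_size rho <= c.
Hypothesis S_gt0 : 0 < S.

(** [ok] constrains the formulas substituted for the atoms of a rule; [fits] is the resulting
    constraint on all lines of the simulation, whose schematic lines have size at most [c]. *)
Definition ok (A : formula V) := (depth A <= d) && (fsize A <= S).

Definition fits (A : formula V) := (depth A <= c + d) && (fsize A <= c * S).

(* The [k] steps are applications of [rules], each simulated by at most [c]
   lines in [F]. *)
Definition prv (k : nat) (As : seq (formula V)) : Prop :=
  exists pi, [/\ proves pi, {subset As <= pi}, all fits pi & size pi <= c * k].

Lemma prv_nil : prv 0 [::].
Proof. by exists [::]; split=> //; exact: proves_nil. Qed.

Lemma prv_leq k k' As : k <= k' -> prv k As -> prv k' As.
Proof.
move=> le_k [pi [h1 h2 h3 h4]]; exists pi; split=> //.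
by apply: leq_trans h4 _; rewrite leq_mul2l le_k orbT.
Qed.

Lemma prv_cat k k' As Bs : prv k As -> prv k' Bs -> prv (k + k') (As ++ Bs).
Proof.
move=> [pi [h1 h2 h3 h4]] [pi' [h1' h2' h3' h4']]; exists (pi ++ pi'); split.
- exact: proves_cat.
- by move=> A; rewrite !mem_cat => /orP[/h2|/h2'] ->; rewrite ?orbT.
- by rewrite all_cat h3.
- by rewrite size_cat mulnDr leq_add.
Qed.

Lemma fsize_le_proof_size (U : eqType) (A : formula U) rho :
  A \in rho -> fsize A <= proof_size rho.
Proof. by move=> Ain; rewrite /proof_size (big_rem A) //= leq_addr. Qed.

Lemma size_le_proof_size (U : Type) (rho : seq (formula U)) :
  size rho <= proof_size rho.
Proof.
by rewrite -sum1_size /proof_size; apply: leq_sum => A _; apply: fsize_gt0.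
Qed.

Lemma prv_rule r args k : r \in rules -> all ok args ->
  prv k (map (subst (nth Bot args)) (premises r)) ->
  prv k.+1 [:: subst (nth Bot args) (conclusion r)].
Proof.
move=> /rules_derivable[rho hrho le_c] /allP ok_args [pi [h1 h2 h3 h4]].
have ok_nth i : ok (nth Bot args i).
  have [lt_i|ge_i] := ltnP i (size args); first by rewrite ok_args ?mem_nth.
  (* Atoms beyond [args] become [Bot], of depth 0 and size 1, hence [ok] since [S] is positive. *)
  by rewrite nth_default.
exists (pi ++ map (subst (nth Bot args)) rho); split.
- exact: proves_derivation hrho h1 h2.
- case: hrho => -[rho' ->] _ A; rewrite inE => /eqP->.
  by rewrite mem_cat map_f ?orbT // mem_rcons mem_head.
- rewrite all_cat h3 /=; apply/allP => _ /mapP[A Ain ->].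
  have le_A := leq_trans (fsize_le_proof_size Ain) le_c.
  apply/andP; split.
    apply: (@leq_trans (fsize A + d)); last by rewrite leq_add2r.
    by apply: depth_subst => i; case/andP: (ok_nth i).
  apply: (@leq_trans (fsize A * S)); last by rewrite leq_mul2r le_A orbT.
  by apply: fsize_subst => // i; case/andP: (ok_nth i).
- rewrite size_cat size_map mulnS addnC leq_add //.
  exact: leq_trans (size_le_proof_size rho) le_c.
Qed.

Lemma prv_frege_proof k A : prv k [:: A] -> exists pi,
  [/\ frege_proof F A pi, proof_depth_le (c + d) pi &
      proof_size pi <= (c * k).+1 * (c * S)].
Proof.
move=> [pi [h1 /(_ A) + h3 h4]]; rewrite mem_head => /(_ isT) Api.
have hfits : all fits (rcons pi A) by rewrite all_rcons h3 (allP h3).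
(* The target is repeated as the last line, whence the successor in the size bound. *)
exists (rcons pi A); split.
- exact: proves_frege_proof.
- by apply: sub_all hfits => B /andP[].
- rewrite /proof_size big_seq; apply: (@leq_trans (\sum_(B <- rcons pi A) c * S)).
    by rewrite [leqRHS]big_seq; apply: leq_sum => B /(allP hfits)/andP[].
  rewrite big_const_seq count_predT size_rcons iter_addn_0 mulnC leq_mul2r.
  by rewrite ltnS h4 orbT.
Qed.

End Simulation.

(** Completeness derives each rule once from its own premises; [c] is the maximum of these finitely
    many sizes and depends only on [F] and [rules]. *)
Lemma frege_rules_derivable (F rules : seq rule) : frege_system F ->
  (forall r, r \in rules -> entails (premises r) (conclusion r)) ->
  exists c, forall r, r \in rules -> exists2 rho,
    derivation F (premises r) (conclusion r) rho & proof_size rho <= c.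
Proof.
move=> [_ complete]; elim: rules => [|r rules IH] sound; first by exists 0.
have [rho hrho] := complete _ _ (sound r (mem_head _ _)).
have [c hc] : exists c, forall r, r \in rules -> exists2 rho,
    derivation F (premises r) (conclusion r) rho & proof_size rho <= c.
  by apply: IH => r' r'in; apply: sound; rewrite inE r'in orbT.
exists (maxn c (proof_size rho)) => r'; rewrite inE => /predU1P[->|/hc[rho' h le_c]].
  by exists rho => //; rewrite leq_maxr.
by exists rho' => //; rewrite leq_max le_c.
Qed.

(** * The schematic rules *)

Local Notation va := (Var 0).
Local Notation vb := (Var 1).
Local Notation vx := (Var 2).
Local Notation vt := (Var 3).

Definition rule_em : rule := ([::], Or va (Neg va)).
Definition rule_inl : rule := ([:: Or va vx], Or (Or va vb) vx).
Definition rule_inr : rule := ([:: Or vb vx], Or (Or va vb) vx).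
Definition rule_top : rule := ([::], Or Top va).
Definition rule_and : rule := ([:: Or va vx; Or vb vx], Or (And va vb) vx).
Definition rule_nbot : rule := ([::], Or (Neg Bot) va).
Definition rule_nor : rule := ([:: Or (Neg va) vx; Or (Neg vb) vx], Or (Neg (Or va vb)) vx).
Definition rule_nand : rule := ([::], Or (And va vb) (Or (Neg va) (Neg vb))).
Definition rule_weakr : rule := ([:: Or va vb], Or vb (Or va vx)).
Definition rule_weakl : rule := ([:: Or va vb], Or vb (Or vx va)).
Definition rule_rot : rule := ([:: Or va (Or vb vx)], Or vx (Or va vb)).
Definition rule_refl : rule := ([::], Or va (Or (Neg vb) vb)).
Definition rule_trans : rule :=
  ([:: Or vt (Or (Neg va) vb); Or vt (Or (Neg vb) vx)],
   Or vt (Or (Neg va) vx)).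
Definition rule_resolve : rule :=
  ([:: Or vt (Or (Neg va) (Neg vb)); Or vt (Or vb vx)],
   Or vt (Or (Neg va) vx)).
(** The four clauses exclude all four values of the pair ([va], [vb]), leaving only the side formula
    [vx], which will be [tau]. *)
Definition rule_refute : rule :=
  ([:: Or vx (Or va vb); Or vx (Or (Neg va) (Neg vb));
       Or vx (Or (Neg va) vb); Or vx (Or (Neg vb) va)], vx).

Definition base_rules : seq rule :=
  [:: rule_em; rule_inl; rule_inr; rule_top; rule_and; rule_nbot; rule_nor;
      rule_nand; rule_weakr; rule_weakl; rule_rot; rule_refl; rule_trans;
      rule_resolve; rule_refute].

Lemma base_rules_sound r : r \in base_rules -> entails (premises r) (conclusion r).
Proof.
(* Only atoms 0 to 3 occur, so sixteen valuations decide the whole list by computation. *)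
move=> rin v; apply/implyP; move: r rin; apply/allP => /=.
by case: (v 0); case: (v 1); case: (v 2); case: (v 3).
Qed.

(** * Derived rules for iterated connectives, with step counts *)

Section BaseCalculus.

Variables (F : seq rule) (V : eqType) (c d S : nat).

Local Notation ok := (@ok V d S).
Local Notation prv := (@prv F V c d S).

Lemma ok_sub (A B : formula V) :
  depth A <= depth B -> fsize A <= fsize B -> ok B -> ok A.
Proof.
move=> le_d le_s /andP[dB sB]; apply/andP.
by split; [apply: leq_trans dB | apply: leq_trans sB].
Qed.

Lemma ok_Or (A B : formula V) : ok (Or A B) -> ok A && ok B.
Proof. by move=> h; apply/andP; split; apply: ok_sub h => /=; lia. Qed.

Lemma ok_And (A B : formula V) : ok (And A B) -> ok A && ok B.
Proof. by move=> h; apply/andP; split; apply: ok_sub h => /=; lia. Qed.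

Lemma ok_big_or (I : eqType) (r : seq I) (P : pred I) (f : I -> formula V) i :
  i \in r -> P i -> ok (\big[@Or V/Bot]_(j <- r | P j) f j) -> ok (f i).
Proof.
move=> + Pi; elim: r => // j r IH; rewrite inE => /predU1P[<-|ir].
  by rewrite big_cons Pi => /ok_Or/andP[].
by rewrite big_cons; case: ifP => _ // => [/ok_Or/andP[_]|]; apply: IH.
Qed.

Hypothesis base_derivable : forall r, r \in base_rules -> exists2 rho,
  derivation F (premises r) (conclusion r) rho & proof_size rho <= c.
Hypothesis S_gt0 : 0 < S.

Lemma prv_base r args k : r \in base_rules -> all ok args ->
  prv k (map (subst (nth Bot args)) (premises r)) ->
  prv k.+1 [:: subst (nth Bot args) (conclusion r)].
Proof. exact: prv_rule. Qed.

Local Ltac base_rule r args :=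
  apply: (@prv_base r args); rewrite ?inE ?eqxx ?orbT //=.

Lemma prv_em A : ok A -> prv 1 [:: Or A (Neg A)].
Proof. by move=> okA; base_rule rule_em [:: A]; rewrite ?okA //; apply: prv_nil. Qed.

Lemma prv_inl k A B X : ok (Or A B) -> ok X ->
  prv k [:: Or A X] -> prv k.+1 [:: Or (Or A B) X].
Proof.
by move=> /ok_Or/andP[okA okB] okX; base_rule rule_inl [:: A; B; X]; rewrite okA okB okX.
Qed.

Lemma prv_inr k A B X : ok (Or A B) -> ok X ->
  prv k [:: Or B X] -> prv k.+1 [:: Or (Or A B) X].
Proof.
by move=> /ok_Or/andP[okA okB] okX; base_rule rule_inr [:: A; B; X]; rewrite okA okB okX.
Qed.

Lemma prv_weakr k A B C : ok A -> ok B -> ok C ->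
  prv k [:: Or A B] -> prv k.+1 [:: Or B (Or A C)].
Proof. by move=> okA okB okC; base_rule rule_weakr [:: A; B; C]; rewrite okA okB okC. Qed.

Lemma prv_weakl k A B C : ok A -> ok B -> ok C ->
  prv k [:: Or A B] -> prv k.+1 [:: Or B (Or C A)].
Proof. by move=> okA okB okC; base_rule rule_weakl [:: A; B; C]; rewrite okA okB okC. Qed.

Lemma prv_rot k A B C : ok A -> ok B -> ok C ->
  prv k [:: Or A (Or B C)] -> prv k.+1 [:: Or C (Or A B)].
Proof. by move=> okA okB okC; base_rule rule_rot [:: A; B; C]; rewrite okA okB okC. Qed.

Lemma prv_nand A B : ok A -> ok B -> prv 1 [:: Or (And A B) (Or (Neg A) (Neg B))].
Proof.
by move=> okA okB; base_rule rule_nand [:: A; B]; rewrite ?okA ?okB //; apply: prv_nil.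
Qed.

Lemma prv_refl A B : ok A -> ok B -> prv 1 [:: Or A (Or (Neg B) B)].
Proof.
by move=> okA okB; base_rule rule_refl [:: A; B]; rewrite ?okA ?okB //; apply: prv_nil.
Qed.

Lemma prv_trans k k' T A B C : ok T -> ok A -> ok B -> ok C ->
  prv k [:: Or T (Or (Neg A) B)] -> prv k' [:: Or T (Or (Neg B) C)] ->
  prv (k + k').+1 [:: Or T (Or (Neg A) C)].
Proof.
move=> okT okA okB okC h h'; base_rule rule_trans [:: A; B; C; T].
  by rewrite okA okB okC okT.
exact: prv_cat h h'.
Qed.

Lemma prv_resolve k k' T A B C : ok T -> ok A -> ok B -> ok C ->
  prv k [:: Or T (Or (Neg A) (Neg B))] -> prv k' [:: Or T (Or B C)] ->
  prv (k + k').+1 [:: Or T (Or (Neg A) C)].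
Proof.
move=> okT okA okB okC h h'; base_rule rule_resolve [:: A; B; C; T].
  by rewrite okA okB okC okT.
exact: prv_cat h h'.
Qed.

Lemma prv_refute k1 k2 k3 k4 T A B : ok T -> ok A -> ok B ->
  prv k1 [:: Or T (Or A B)] -> prv k2 [:: Or T (Or (Neg A) (Neg B))] ->
  prv k3 [:: Or T (Or (Neg A) B)] -> prv k4 [:: Or T (Or (Neg B) A)] ->
  prv (k1 + (k2 + (k3 + k4))).+1 [:: T].
Proof.
move=> okT okA okB h1 h2 h3 h4; base_rule rule_refute [:: A; B; T].
  by rewrite okA okB okT.
exact: (prv_cat h1 (prv_cat h2 (prv_cat h3 h4))).
Qed.

(** One left injection at [i], then at most one right injection for each earlier index; [X] is
    carried along as a side formula. *)
Lemma prv_big_or (I : eqType) (r : seq I) (P : pred I) (f : I -> formula V) i k l X :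
  size r = l -> i \in r -> P i -> ok (\big[@Or V/Bot]_(j <- r | P j) f j) -> ok X ->
  prv k [:: Or (f i) X] ->
  prv (k + l) [:: Or (\big[@Or V/Bot]_(j <- r | P j) f j) X].
Proof.
move=> <- + Pi + okX h; elim: r => // j r IH.
rewrite inE => /predU1P[<-|ir]; rewrite big_cons /= ?Pi.
  move=> okr; apply: (@prv_leq _ _ _ _ _ k.+1); first by lia.
  exact: prv_inl.
case: ifP => Pj okr; last first.
  by apply: (@prv_leq _ _ _ _ _ (k + size r)); [lia | exact: IH].
rewrite addnS; apply: prv_inr => //; apply: IH => //.
by case/ok_Or/andP: okr.
Qed.

(** Starting from [Top], each index costs [k] steps for its conjunct and one use of [rule_and]. *)
Lemma prv_big_and (I : eqType) (r : seq I) (P : pred I) (f : I -> formula V) k l X :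
  size r = l -> ok (\big[@And V/Top]_(j <- r | P j) f j) -> ok X ->
  (forall i, P i -> prv k [:: Or (f i) X]) ->
  prv (l * k.+1).+1 [:: Or (\big[@And V/Top]_(j <- r | P j) f j) X].
Proof.
move=> <- + okX h; elim: r => [|j r IH].
  rewrite big_nil mul0n => _; base_rule rule_top [:: X]; first by rewrite okX.
  exact: prv_nil.
rewrite big_cons /=; case: ifP => Pj okr; last first.
  by apply: prv_leq (IH okr); lia.
have /andP[okj okr'] := ok_And okr.
apply: (@prv_leq _ _ _ _ _ (k + (size r * k.+1).+1).+1); first by lia.
base_rule rule_and [:: f j; \big[@And V/Top]_(i <- r | P i) f i; X].
  by rewrite okj okr' okX.
exact: prv_cat (h j Pj) (IH okr').
Qed.

(** De Morgan dual of the conjunction case, with [Neg Bot] as the base and the same count. *)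
Lemma prv_big_nor (I : eqType) (r : seq I) (P : pred I) (f : I -> formula V) k l X :
  size r = l -> ok (\big[@Or V/Bot]_(j <- r | P j) f j) -> ok X ->
  (forall i, P i -> prv k [:: Or (Neg (f i)) X]) ->
  prv (l * k.+1).+1 [:: Or (Neg (\big[@Or V/Bot]_(j <- r | P j) f j)) X].
Proof.
move=> <- + okX h; elim: r => [|j r IH].
  rewrite big_nil mul0n => _; base_rule rule_nbot [:: X]; first by rewrite okX.
  exact: prv_nil.
rewrite big_cons /=; case: ifP => Pj okr; last first.
  by apply: prv_leq (IH okr); lia.
have /andP[okj okr'] := ok_Or okr.
apply: (@prv_leq _ _ _ _ _ (k + (size r * k.+1).+1).+1); first by lia.
base_rule rule_nor [:: f j; \big[@Or V/Bot]_(i <- r | P i) f i; X].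
  by rewrite okj okr' okX.
exact: prv_cat (h j Pj) (IH okr').
Qed.

End BaseCalculus.

(** * Size and depth of iterated connectives *)

Lemma fsize_big (V I : Type) (op : formula V -> formula V -> formula V) z
    (r : seq I) (P : pred I) (f : I -> formula V) B k :
  size r = k -> (forall A C, fsize (op A C) = (fsize A + fsize C).+1) -> fsize z = 1 ->
  (forall i, fsize (f i) <= B) ->
  fsize (\big[op/z]_(i <- r | P i) f i) <= (k * B.+1).+1.
Proof.
move=> <- hop hz hf; elim: r => [|i r IH]; first by rewrite big_nil hz.
rewrite big_cons /=; case: ifP => _; first by rewrite hop; have := hf i; lia.
lia.
Qed.

Lemma depth_big_or (V I : Type) (r : seq I) (P : pred I) (f : I -> formula V) e :
  (forall i, depth (f i) <= e) -> depth (\big[@Or V/Bot]_(i <- r | P i) f i) <= e.+1.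
Proof.
move=> hf; set A := \big[_/_]_(_ <- _ | _) _.
(* The induction needs this stronger quantity, the contribution of [A] below another [Or]: it does
   not grow when one more disjunct is added. *)
apply: (@leq_trans (depth A + ~~ is_or A)); first exact: leq_addr.
rewrite {}/A; elim: r => [|i r IH]; first by rewrite big_nil.
rewrite big_cons; case: ifP => //= _; rewrite addn0 geq_max IH andbT.
by rewrite -addn1 leq_add // leq_b1.
Qed.

Lemma depth_big_and (V I : Type) (r : seq I) (P : pred I) (f : I -> formula V) e :
  (forall i, depth (f i) <= e) -> depth (\big[@And V/Top]_(i <- r | P i) f i) <= e.+1.
Proof.
move=> hf; set A := \big[_/_]_(_ <- _ | _) _.
apply: (@leq_trans (depth A + ~~ is_and A)); first exact: leq_addr.
rewrite {}/A; elim: r => [|i r IH]; first by rewrite big_nil.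
rewrite big_cons; case: ifP => //= _; rewrite addn0 geq_max IH andbT.
by rewrite -addn1 leq_add // leq_b1.
Qed.

Lemma size_index_enum (T : finType) : size (index_enum T) = #|T|.
Proof. by rewrite -sum1_size sum1_card. Qed.

Lemma size_index_enum_ord n : size (index_enum 'I_n) = n.
Proof. by rewrite size_index_enum card_ord. Qed.

Lemma size_index_enum_ord2 n : size (index_enum ('I_n * 'I_n)%type) = n * n.
Proof. by rewrite size_index_enum card_prod card_ord. Qed.

Lemma depth_Or (V : Type) (A B : formula V) :
  depth (Or A B) <= (maxn (depth A) (depth B)).+1.
Proof. by rewrite /=; case: (is_or A); case: (is_or B); lia. Qed.

Lemma depth_Neg (V : Type) (A : formula V) : depth (Neg A) <= (depth A).+1.
Proof. by rewrite /=; case: (is_neg A); lia. Qed.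

Lemma fsize_Or (V : Type) (A B : formula V) :
  fsize (Or A B) = (fsize A + fsize B).+1.
Proof. by []. Qed.

(** * The bipartite double cover *)

Definition double_cover (n : nat) (G : rel 'I_n) : rel ('I_n * bool) :=
  fun u v => G u.1 v.1 && (u.2 != v.2).

Lemma double_cover_connect_sym n (G : rel 'I_n) :
  symmetric G -> connect_sym (double_cover G).
Proof.
move=> symG; apply: sym_connect_sym => u v.
by rewrite /double_cover symG eq_sym.
Qed.

(** A walk lifts to the cover by flipping the bit at each edge; [b] is the parity of its length. *)
Lemma connect_double_cover n (G : rel 'I_n) x y :
  connect G x y -> exists b, connect (double_cover G) (x, false) (y, b).
Proof.
case/connectP=> p + ->; elim/last_ind: p => [|p z IH]; first by exists false.
rewrite rcons_path last_rcons => /andP[/IH[b hb] hz]; exists (~~ b).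
by apply: connect_trans hb (connect1 _); rewrite /double_cover hz /=; case: b.
Qed.

(* If no vertex is connected to its twin, the vertices in the cover component
   of (r, false), for r a chosen root of each component of G, form one side of
   a bipartition. *)
Lemma not_bipartite_twins n (G : rel 'I_n) : symmetric G -> ~ bipartite G ->
  exists x, connect (double_cover G) (x, false) (x, true).
Proof.
move=> symG; have symC := double_cover_connect_sym symG.
case: (boolP [exists x, connect (double_cover G) (x, false) (x, true)]).
  by move=> /existsP.
rewrite negb_exists => /forallP no_twins []; exists
  [set x | connect (double_cover G) (fingraph.root G x, false) (x, false)].
move=> x y Gxy; rewrite !inE.
have symcG := sym_connect_sym symG.
(* Adjacent vertices share a root, so both memberships refer to one cover component. *)
have <- : fingraph.root G x = fingraph.root G y.
  exact/(fingraph.rootP symcG)/connect1.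
set r := fingraph.root G x.
have edge u v b : G u v -> connect (double_cover G) (u, b) (v, ~~ b).
  by move=> Guv; apply: connect1; rewrite /double_cover Guv; case: b.
have [b hb] : exists b, connect (double_cover G) (r, false) (y, b).
  apply: connect_double_cover; apply: connect_trans (connect1 Gxy).
  by rewrite symcG connect_root.
(* If (x, false) is in the component, so is (y, true), and (y, false) would then make [y] connected
   to its twin. Otherwise the bit reached over [y] is false, since (y, true) is adjacent to (x,
   false). *)
case: (boolP (connect _ _ (x, false))) => hx.
  apply/negP => /eqP/esym hy; have /negP := no_twins y; apply.
  rewrite symC in hy; apply: connect_trans hy _.
  exact: connect_trans hx (edge _ _ _ Gxy).
case: b hb => [hb|->] //; case/negP: hx; apply: connect_trans hb _.
by apply: (edge y x true); rewrite symG.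
Qed.

(** A path without repetitions visits at most 2n vertices of the cover. *)
Lemma double_cover_walk n (G : rel 'I_n) u v : connect (double_cover G) u v ->
  exists p, [/\ path (double_cover G) u p, last u p = v & size p <= n * 2].
Proof.
case/connectP=> p hp ->; case: (shortenP hp) => q hq uq _; exists q; split=> //.
have := max_card [in u :: q]; rewrite (card_uniqP uq) card_prod card_ord card_bool /=.
exact: ltnW.
Qed.

(** * The short proof of [tau] *)

Section Homomorphism.

Variables (F : seq rule) (c n m : nat) (G : rel 'I_n) (H : rel 'I_m) (B : {set 'I_m}).

Local Notation V := ('I_n * 'I_m)%type.
Local Notation N := (n + m).+1.
Local Notation d := 7.
(** Together with [d], this bounds every formula substituted for an atom: parts of [T], sides,
    literals and short disjunctions of these. *)
Local Notation S := (100 * N ^ 4).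
Local Notation T := (tau G H).
Local Notation ok := (@ok V d S).
Local Notation prv := (@prv F V c d S).

Hypothesis base_derivable : forall r, r \in base_rules -> exists2 rho,
  derivation F (premises r) (conclusion r) rho & proof_size rho <= c.
Hypothesis bipartB : forall x y, H x y -> (x \in B) != (y \in B).

(** This is Q(y, b) for the vertex [u] = (y, b) of the double cover. *)
Definition lands (u : 'I_n * bool) : formula V :=
  \OR_(j : 'I_m | (j \in B) == u.2) Var (u.1, j).

Let S_gt0 : 0 < S.
Proof. by rewrite muln_gt0 expn_gt0. Qed.

Let tau_total : formula V := \OR_(i : 'I_n) \AND_(j : 'I_m) Neg (Var (i, j)).
Let tau_func : formula V :=
  \OR_(i : 'I_n) \OR_(jj : 'I_m * 'I_m | jj.1 != jj.2)
    And (Var (i, jj.1)) (Var (i, jj.2)).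
Let tau_edge : formula V :=
  \OR_(ii : 'I_n * 'I_n | G ii.1 ii.2)
    \OR_(jj : 'I_m * 'I_m | ~~ H jj.1 jj.2)
      And (Var (ii.1, jj.1)) (Var (ii.2, jj.2)).

Let tauE : T = Or tau_total (Or tau_func tau_edge).
Proof. by []. Qed.

Lemma depth_tau : depth T <= 5.
Proof.
have h1 : depth tau_total <= 3.
  by apply: depth_big_or => i; apply: depth_big_and.
have h2 : depth tau_func <= 3.
  by apply: depth_big_or => i; apply: depth_big_or.
have h3 : depth tau_edge <= 3.
  by apply: depth_big_or => i; apply: depth_big_or.
rewrite tauE; apply: leq_trans (depth_Or _ _) _.
by have := depth_Or tau_func tau_edge; lia.
Qed.

(** [N] is positive and dominates [n] and [m], so all counts below, constants included, reduce to a
    single power of [N]. *)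
Let monomial_le i j k : i + j <= k -> n ^ i * m ^ j <= N ^ k.
Proof.
move=> le_k; apply: (@leq_trans (N ^ i * N ^ j)).
  by apply: leq_mul; [case: i {le_k} | case: j {le_k}] => // e; rewrite leq_exp2r //; lia.
by rewrite -expnD leq_pexp2l.
Qed.

Lemma fsize_tau : fsize T <= 24 * N ^ 4.
Proof.
have szm := size_index_enum_ord m; have szn := size_index_enum_ord n.
have szmm := size_index_enum_ord2 m; have sznn := size_index_enum_ord2 n.
have h1 : fsize tau_total <= (n * (m * 3).+2).+1.
  by apply: (fsize_big _ szn) => // i; apply: (fsize_big _ szm).
have h2 : fsize tau_func <= (n * (m * m * 5).+2).+1.
  by apply: (fsize_big _ szn) => // i; apply: (fsize_big _ szmm).
have h3 : fsize tau_edge <= (n * n * (m * m * 5).+2).+1.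
  by apply: (fsize_big _ sznn) => // i; apply: (fsize_big _ szmm).
have := (@monomial_le 1 1 4 isT, @monomial_le 1 0 4 isT, @monomial_le 0 0 4 isT,
  @monomial_le 1 2 4 isT, @monomial_le 2 2 4 isT, @monomial_le 2 0 4 isT).
rewrite tauE /= !expn0 !expn1 -!mulnn !mul1n !muln1; move: (N ^ 4) => K.
by case=> [[[[[]]]]]; nia.
Qed.

Lemma depth_lands u : depth (lands u) <= 1.
Proof. exact: depth_big_or. Qed.

Lemma fsize_lands u : fsize (lands u) <= 3 * N ^ 4.
Proof.
have h : fsize (lands u) <= (m * 2).+1.
  by apply: (fsize_big _ (size_index_enum_ord m)).
have := (@monomial_le 0 1 4 isT, @monomial_le 0 0 4 isT).
by rewrite !expn0 !expn1 !mul1n; move: (N ^ 4) h => K h []; lia.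
Qed.

Let N4_gt0 : 0 < N ^ 4. Proof. by rewrite expn_gt0. Qed.

Let okI (A : formula V) : depth A <= d -> fsize A <= S -> ok A.
Proof. by move=> dA sA; apply/andP. Qed.

Let ok_lands u : ok (lands u).
Proof.
by apply: okI; [have := depth_lands u | have := fsize_lands u]; lia.
Qed.

Let ok_Neg_lands u : ok (Neg (lands u)).
Proof.
apply: okI.
  by apply: leq_trans (depth_Neg _) _; have := depth_lands u; lia.
by have := fsize_lands u; rewrite /=; lia.
Qed.

Let ok_tau : ok T.
Proof.
apply: okI; [have := depth_tau | have := fsize_tau]; lia.
Qed.

Let ok_var v : ok (Var v).
Proof. by apply: okI; rewrite //=; lia. Qed.

Let ok_nvar v : ok (Neg (Var v)).
Proof. by apply: okI; rewrite //=; lia. Qed.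

Let ok_or_nvars v w : ok (Or (Neg (Var v)) (Neg (Var w))).
Proof. by apply: okI; rewrite //=; lia. Qed.

Let ok_or_lands u v : ok (Or (lands u) (lands v)).
Proof.
apply: okI.
  by apply: leq_trans (depth_Or _ _) _; have := depth_lands u; have := depth_lands v; lia.
by have := fsize_lands u; have := fsize_lands v; rewrite /=; lia.
Qed.

Let ok_tau_nvar v : ok (Or T (Neg (Var v))).
Proof.
apply: okI.
  by apply: leq_trans (depth_Or _ _) _; have := depth_tau; rewrite [depth (Neg _)]/=; lia.
by have := fsize_tau; rewrite fsize_Or [fsize (Neg _)]/=; lia.
Qed.

Let ok_tau_lands u : ok (Or (Neg (lands u)) T).
Proof.
apply: okI.
  apply: leq_trans (depth_Or _ _) _; have := depth_tau.
  by have := depth_Neg (lands u); have := depth_lands u; lia.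
by have := fsize_tau; have := fsize_lands u; rewrite fsize_Or [fsize (Neg _)]/=; lia.
Qed.

Let ok_tau_parts :
  [/\ ok tau_total, ok (Or tau_func tau_edge), ok tau_func & ok tau_edge].
Proof.
move: ok_tau; rewrite tauE => /ok_Or/andP[oktot okrest].
by case/ok_Or/andP: (okrest).
Qed.

(** If neither side holds at the vertex, all its variables are false, which is a disjunct of
    [tau_total]. *)
Lemma prv_lands_or u : prv (8 * N ^ 2) [:: Or T (Or (lands u) (lands (u.1, ~~ u.2)))].
Proof.
set X := Or (lands _) _; have okX : ok X by apply: ok_or_lands.
have step j : prv (1 + m).+1 [:: Or (Neg (Var (u.1, j))) X].
  (* From excluded middle: the variable for [j] is a disjunct of the formula for the side containing
     [j]. *)
  have inj w : w.1 = u.1 -> (j \in B) == w.2 ->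
      prv (1 + m) [:: Or (lands w) (Neg (Var (u.1, j)))].
    move=> <- hj.
    apply: (prv_big_or base_derivable S_gt0 (size_index_enum_ord m)
             (mem_index_enum j)) => //.
    - exact: ok_lands w.
    - exact: prv_em.
  have [hj|hj] := boolP ((j \in B) == u.2).
    by apply: prv_weakr => //; apply: inj.
  apply: prv_weakl => //; apply: inj => //=.
  by move: hj; case: (_ \in _); case: (u.2).
have [oktot okrest _ _] := ok_tau_parts.
have okall : ok (\AND_(j : 'I_m) Neg (Var (u.1, j))).
  exact: (ok_big_or (mem_index_enum u.1) _ oktot).
have h : prv ((m * (1 + m).+2).+1 + n).+1 [:: Or T X].
  rewrite tauE; apply: prv_inl => //.
  apply: (prv_big_or base_derivable S_gt0 (size_index_enum_ord n)
           (mem_index_enum u.1)) => //.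
  exact: prv_big_and (size_index_enum_ord m) _ _ _.
apply: prv_leq h.
have := (@monomial_le 0 2 2 isT, @monomial_le 1 0 2 isT, @monomial_le 0 0 2 isT,
  @monomial_le 0 1 2 isT).
rewrite !expn0 !expn1 -!mulnn !mul1n !muln1; move: (N * N) => K.
by case=> [[[]]]; nia.
Qed.

(** The conjunction of the two variables is a disjunct of [tau_func]: [rule_nand] puts their
    negations beside it, and injections then build [T]. *)
Lemma prv_func i j j' : j != j' ->
  prv (6 * N ^ 2) [:: Or T (Or (Neg (Var (i, j))) (Neg (Var (i, j'))))].
Proof.
move=> neq_j; have [oktot okrest okf _] := ok_tau_parts.
have h : prv (1 + m * m + n).+2 [:: Or T (Or (Neg (Var (i, j))) (Neg (Var (i, j'))))].
  rewrite tauE; apply: prv_inr => //; apply: prv_inl => //.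
  apply: (prv_big_or base_derivable S_gt0 (size_index_enum_ord n)
           (mem_index_enum i)) => //.
  apply: (prv_big_or base_derivable S_gt0 (size_index_enum_ord2 m)
           (mem_index_enum (j, j'))) => //.
    exact: (ok_big_or (mem_index_enum i) _ okf).
  exact: prv_nand.
apply: prv_leq h.
have := (@monomial_le 0 2 2 isT, @monomial_le 1 0 2 isT, @monomial_le 0 0 2 isT).
rewrite !expn0 !expn1 -!mulnn !mul1n !muln1; move: (N * N) => K.
by case=> [[]]; lia.
Qed.

Lemma prv_edge i i' j j' : G i i' -> ~~ H j j' ->
  prv (6 * N ^ 2) [:: Or T (Or (Neg (Var (i, j))) (Neg (Var (i', j'))))].
Proof.
move=> Gi Hj; have [oktot okrest _ oke] := ok_tau_parts.
have h : prv (1 + m * m + n * n).+2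
    [:: Or T (Or (Neg (Var (i, j))) (Neg (Var (i', j'))))].
  rewrite tauE; apply: prv_inr => //; apply: prv_inr => //.
  apply: (prv_big_or base_derivable S_gt0 (size_index_enum_ord2 n)
           (mem_index_enum (i, i'))) => //.
  apply: (prv_big_or base_derivable S_gt0 (size_index_enum_ord2 m)
           (mem_index_enum (j, j'))) => //.
    exact: (ok_big_or (mem_index_enum (i, i')) _ oke).
  exact: prv_nand.
apply: prv_leq h.
have := (@monomial_le 0 2 2 isT, @monomial_le 2 0 2 isT, @monomial_le 0 0 2 isT).
rewrite !expn0 -!mulnn !mul1n !muln1; move: (N * N) => K.
by case=> [[]]; lia.
Qed.

(** De Morgan on both disjunctions reduces the claim to at most m * m pairs of variables. *)
Lemma prv_lands_clash u v :
  (forall j j', (j \in B) == u.2 -> (j' \in B) == v.2 ->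
    prv (6 * N ^ 2) [:: Or T (Or (Neg (Var (u.1, j))) (Neg (Var (v.1, j'))))]) ->
  prv (13 * N ^ 4) [:: Or T (Or (Neg (lands u)) (Neg (lands v)))].
Proof.
move=> h; set k := 6 * N ^ 2 in h.
have h' : prv (m * ((m * k.+2).+2).+1).+2 [:: Or T (Or (Neg (lands u)) (Neg (lands v)))].
  (* Three rotations, interleaved with the two De Morgan steps, bring each disjunction to the front
     in turn and restore the order. *)
  apply: prv_rot => //.
  apply: (prv_big_nor base_derivable S_gt0 (size_index_enum_ord m)) => //.
    exact: ok_lands.
  move=> j hj; apply: prv_rot => //.
  apply: (prv_big_nor base_derivable S_gt0 (size_index_enum_ord m)) => //.
    exact: ok_lands.
  by move=> j' hj'; apply: prv_rot => //; apply: h.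
apply: prv_leq h'.
have := (@monomial_le 0 2 2 isT, @monomial_le 0 2 4 isT, @monomial_le 0 1 4 isT,
  @monomial_le 0 0 4 isT).
have : m * m * N ^ 2 <= N ^ 4.
  rewrite -[N ^ 4]/(N ^ (2 + 2)) expnD leq_mul2r mulnn.
  by have := @monomial_le 0 2 2 isT; rewrite expn0 mul1n => ->; rewrite orbT.
rewrite /k !expn0 !expn1 !mul1n ?muln1 -[m ^ 2]mulnn.
by move: (N ^ 2) (N ^ 4) => K L hL [[[]]]; nia.
Qed.

(** Both ends of the edge cannot land on the same side, as [H] has no edge within a side; resolving
    this with the alternative for [v] gives the implication. *)
Lemma prv_step u v : double_cover G u v ->
  prv (22 * N ^ 4) [:: Or T (Or (Neg (lands u)) (lands v))].
Proof.
case: u v => [y b] [z b'] /andP[/= Gyz neq_b].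
have h1 : prv (13 * N ^ 4) [:: Or T (Or (Neg (lands (y, b))) (Neg (lands (z, b))))].
  apply: prv_lands_clash => j j' /= /eqP hj /eqP hj'; apply: prv_edge => //.
  by apply/negP => /bipartB; rewrite hj hj' eqxx.
have h2 := prv_lands_or (z, b); rewrite /= in h2.
have Eb : b' = ~~ b by case: b b' neq_b {h1 h2} => -[].
rewrite Eb; apply: prv_leq (prv_resolve base_derivable S_gt0 _ _ _ _ h1 h2) => //.
have : N ^ 2 <= N ^ 4 by rewrite leq_pexp2l.
by move: (N ^ 2) (N ^ 4) N4_gt0 => K L; lia.
Qed.

Lemma prv_walk u p : path (double_cover G) u p ->
  prv (size p * (22 * N ^ 4).+1).+1 [:: Or T (Or (Neg (lands u)) (lands (last u p)))].
Proof.
elim/last_ind: p => [_|p v IH]; first exact: prv_refl.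
rewrite rcons_path last_rcons size_rcons => /andP[/IH hp /prv_step hv].
by apply: prv_leq (prv_trans base_derivable S_gt0 _ _ _ _ hp hv) => //; lia.
Qed.

Lemma prv_tau : symmetric G -> ~ bipartite G -> prv (120 * N ^ 5) [:: T].
Proof.
move=> symG nbip; have [y conn] := not_bipartite_twins symG nbip.
(* Connectivity is symmetric, which gives a return walk for the converse implication. *)
have conn' := conn; rewrite double_cover_connect_sym // in conn'.
have [p [hp last_p size_p]] := double_cover_walk conn.
have [q [hq last_q size_q]] := double_cover_walk conn'.
have h1 := prv_lands_or (y, false).
(* Values on different sides are distinct, so functionality excludes both sides at [y]. *)
have h2 : prv (13 * N ^ 4)
    [:: Or T (Or (Neg (lands (y, false))) (Neg (lands (y, true))))].
  apply: prv_lands_clash => j j' /= /eqP hj /eqP hj'; apply: prv_func.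
  by apply/eqP => Ej; rewrite -Ej hj in hj'.
have h3 := prv_walk hp; have h4 := prv_walk hq.
rewrite last_p last_q in h3 h4.
apply: prv_leq (prv_refute base_derivable S_gt0 _ _ _ h1 h2 h3 h4) => //.
(* The sum is at most 8 + 13 + 2 * 46 + 3 = 116 times [N ^ 5]: two sides, their clash, two walks,
   and the single steps. *)
have K2 : N ^ 2 <= N ^ 5 by rewrite leq_pexp2l.
have K4 : N ^ 4 <= N ^ 5 by rewrite leq_pexp2l.
have K5 : 0 < N ^ 5 by rewrite expn_gt0.
have nK : n * (22 * N ^ 4).+1 <= 23 * N ^ 5.
  have : n * N ^ 4 <= N ^ 5 by rewrite (expnS N 4) leq_mul2r; lia.
  by have := @monomial_le 1 0 5 isT; rewrite expn0 expn1 muln1; lia.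
have le_walk r : r <= n * 2 -> r * (22 * N ^ 4).+1 <= 46 * N ^ 5.
  move=> le_r; apply: (@leq_trans (n * 2 * (22 * N ^ 4).+1)); last by lia.
  by rewrite leq_mul2r le_r orbT.
have := le_walk _ size_p; have := le_walk _ size_q.
move: (size p * _) (size q * _) => P Q; move: (N ^ 2) (N ^ 4) (N ^ 5) K2 K4 K5.
by move=> *; lia.
Qed.

End Homomorphism.

(** * The polynomial bound and the conclusion *)

Lemma horner_pow_of_sum (c e n m : nat) :
  ((c%:P%:P * ('X + 'X%:P + 1) ^+ e : {poly {poly nat}}).[n%:P].[m])%R
    = c * (n + m).+1 ^ e.
Proof.
have powE (k l : nat) : (k ^+ l)%R = k ^ l.
  by elim: l => // l IH; rewrite expnS -IH.
rewrite !(hornerM, horner_exp, hornerD, hornerX, hornerC, hornerE) powE.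
by rewrite -addn1.
Qed.

Theorem theorem4 (F : seq rule) (hF : frege_system F) :
  exists (d : nat) (p : {poly {poly nat}}),
    forall (n m : nat) (G : rel 'I_n) (H : rel 'I_m),
      simple_graph G -> simple_graph H -> ~ bipartite G -> bipartite H ->
      exists pi : seq (formula ('I_n * 'I_m)%type),
        [/\ frege_proof F (tau G H) pi,
            proof_depth_le d pi &
            proof_size pi <= (p.[n%:P].[m])%R].
Proof.
have [c hc] := frege_rules_derivable hF base_rules_sound.
(* The outer ['X] stands for [n] and the inner one, ['X%:P], for [m]. The exponent 9 is 5 for the
   number of lines plus 4 for the size of each. *)
exists (c + 7), (((c * 120).+1 * (c * 100))%:P%:P * ('X + 'X%:P + 1) ^+ 9)%R.
move=> n m G H [symG _] _ nbip [B hB].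
have [pi [hpi dpi spi]] := prv_frege_proof (prv_tau hc hB symG nbip).
exists pi; split=> //; rewrite horner_pow_of_sum; apply: leq_trans spi _.
(* Positivity of the fifth power absorbs the extra last line into the coefficient. *)
rewrite (expnD _ 5 4); have : 0 < (n + m).+1 ^ 5 by rewrite expn_gt0.
move: (_ ^ 5) (_ ^ 4) => K L K_gt0.
rewrite mulnACA; apply: leq_mul; last by rewrite mulnA.
by rewrite mulnA [leqRHS]mulSn; move: (c * 120 * K); lia.
Qed.
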